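(* For each positive integer $m$ and $0<a<1$, let $L_m(a)$ be the error of the best uniform approximation of $\operatorname{sgn}(x)$ on $[-1,-a]\cup[a,1]$ by polynomials of degree at most $2m+1$. For each $m$ let $a_m\in(0,1)$ be the number satisfying $a_m=L_m(a_m)$, and let $p_m$ be the polynomial of degree at most $2m+1$ of least uniform deviation from $\operatorname{sgn}(x)$ on $[-1,-a_m]\cup[a_m,1]$. Then $$\lim_{m\to\infty}\frac{m}{\log m}\,\mathcal{L}(\operatorname{sgn},p_m)=\frac{1}{2}.$$
   Context: $\operatorname{sgn}(x)=1$ for $x>0$, $\operatorname{sgn}(x)=-1$ for $x<0$, $\operatorname{sgn}(0)=0$. The quantity $\mathcal{L}$ is defined by $$\mathcal{L}(f,g)=\inf\{h:\ f(x-h)-h\le g(x)\le f(x+h)+h\ \text{ for } -1\le x\le 1\},$$ where $h\ge 0$ and $f=\operatorname{sgn}$ is regarded as a function on the whole real line. $L_m(a)=\min_p\max_{x\in[-1,-a]\cup[a,1]}|p(x)-\operatorname{sgn}(x)|$ over all polynomials $p$ of degree at most $2m+1$; by Chebyshev's theory the minimizing polynomial is unique. *)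

(* Defs.v *)
From HB Require Import structures.
From mathcomp Require Import all_boot all_order all_algebra.
From mathcomp Require Import all_classical all_reals all_analysis.

Set Implicit Arguments.
Unset Strict Implicit.
Unset Printing Implicit Defensive.

Import Order.TTheory GRing.Theory Num.Theory.
Import numFieldNormedType.Exports.

Local Open Scope classical_set_scope.
Local Open Scope ring_scope.

Definition two_intervals (R : realType) (a : R) : set R :=
  `[-1, - a] `|` `[a, 1].

(* For 0 < a < 1 this set of values is nonempty and bounded, and the supremum
   is attained by compactness (sgn is continuous on the two intervals). *)
Definition sgn_error (R : realType) (a : R) (p : {poly R}) : R :=
  sup [set `|p.[x] - Num.sg x| | x in two_intervals a].

(* size p = deg p + 1, so this is deg p <= 2m + 1. *)
Definition admissible (R : realType) (m : nat) : set {poly R} :=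
  [set p | (size p <= (2 * m + 1).+1)%N].

Definition best_sgn_error (R : realType) (m : nat) (a : R) : R :=
  inf [set sgn_error a p | p in @admissible R m].

Definition best_sgn_approx (R : realType) (m : nat) (a : R) (p : {poly R}) :
    Prop :=
  admissible m p /\
  forall q : {poly R}, admissible m q -> sgn_error a p <= sgn_error a q.

(* f is evaluated outside [-1, 1]; only the values of g on [-1, 1] matter. *)
Definition levy_dist (R : realType) (f g : R -> R) : R :=
  inf [set h : R | 0 <= h /\
    forall x : R, -1 <= x <= 1 -> f (x - h) - h <= g x <= f (x + h) + h].

(* Main.v *)
Require Import Defs.
From HB Require Import structures.
From mathcomp Require Import all_boot all_order all_algebra.
From mathcomp Require Import all_classical all_reals all_analysis.
From mathcomp Require Import polyrcf.
From mathcomp Require Import ring lra.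

Set Implicit Arguments.
Unset Strict Implicit.
Unset Printing Implicit Defensive.

Import Order.TTheory GRing.Theory Num.Theory.
Import numFieldNormedType.Exports.

Local Open Scope classical_set_scope.
Local Open Scope ring_scope.

(**
Write L for the error of p := p m on the two intervals; the hypotheses say
L = a m =: a. The proof has two independent halves.

The Levy distance is exactly a. If h < a were feasible, p would lie within h
of sgn on the larger set h < |x| <= 1, so its error on [-1,-a] U [a,1] would be
at most h < a ([levy_dist_best_approx]). Conversely h = a is feasible as soon as
|p| <= 1 + a on the gap (-a, a), and in fact |p| <= 1 there
([best_approx_le1_on_gap]). Suppose p x0 > 1 with x0 in the gap. Follow the
signs of p - 1 at x0 and then at the points of [a,1] where |p - 1| = L, and
those of p + 1 to the left of x0. If the total number of sign changes is at most
2m+1, a polynomial of degree at most 2m+1 has these signs at all extremal points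
([sign_polynomial]) and subtracting a small multiple of it lowers the error
([strict_improvement]). Otherwise p zigzags along 2m+3 points, x0 being
among them, and p^`() changes sign too often for its degree
([size_alternating_poly]).

The fixed point satisfies a ~ ln m / (2m). Put rho = (1-a)/(1+a). Up to factors
that do not matter on the logarithmic scale, L behaves like rho^m, that is
like exp (-2am), and a = exp (-2am) forces 2am ~ ln m.

Upper bound, L <= 2 rho^(m+1) ([best_error_upper_bound]). Since
1/sqrt y = (2/pi) int_0^oo ds/(y + s^2), it is enough to approximate each
1/(y + t), t >= 0, by polynomials of degree m on [a^2, 1] with relative error
1/C(-t) <= 2 rho^(m+1), where C is the Chebyshev polynomial of degree m+1 of
that interval: take (1 - C(y)/C(-t))/(y + t). Finite Riemann sums of the
integral suffice, and multiplying by x = sqrt y gives odd polynomials in x of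
degree 2m+1.

Lower bound ([sgn_error_lower_bound]). For d = a/N the even part of
p(x+d) - p(x-d) is a polynomial of degree m in y = x^2, bounded by 2L where
a+d <= |x| <= 1-d, whereas its values at N points of the gap telescope to
p a - p (-a) >= 2 - 2L. Growth of polynomials outside an interval
([chebyshev_growth]) bounds each of these values by 2L times about
exp (2am(1 + 1/N)), and N may be taken as large as desired.
*)

(** * Sign alternation and degree of polynomials *)

Section Alternation.
Variable R : realType.
Implicit Types (f h E : R -> R) (c e x z : R) (s t : seq R) (g p r : {poly R}).

Fixpoint alternates f e s : Prop :=
  if s is x :: s' then 0 < e * f x /\ alternates f (- e) s' else True.

Fixpoint zigzag f e x s : Prop :=
  if s is y :: s' then 0 < e * (f y - f x) /\ zigzag f (- e) y s' else True.

Lemma alternates_ext f h e s :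
  {in s, forall x, f x != 0 -> 0 < f x * h x} -> alternates f e s ->
  alternates h e s.
Proof.
elim: s e => //= x s IH e fh [ex es]; split.
  have fx0 : f x != 0 by apply: contraTneq ex => ->; rewrite mulr0 ltxx.
  have := fh x (mem_head _ _) fx0; nra.
by apply: IH => // y ys; apply: fh; rewrite in_cons ys orbT.
Qed.

Lemma alternates_scale f c e s : 0 < c ->
  alternates f e s -> alternates f (c * e) s.
Proof.
move=> c0; elim: s e => //= x s IH e [ex es]; split; first by nra.
by rewrite -mulrN; apply: IH.
Qed.

Lemma alternates_unscale f c e s : 0 < c ->
  alternates f (c * e) s -> alternates f e s.
Proof.
by move=> c0 /(@alternates_scale _ c^-1); rewrite invr_gt0 mulKf ?gt_eqF//; apply.
Qed.

Lemma alternates_opp f e s :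
  alternates f (- e) s -> alternates (fun x => - f x) e s.
Proof.
by elim: s e => //= x s IH e [ex /IH]; rewrite mulrN -mulNr.
Qed.

Lemma alternates_map_opp f e s :
  alternates (fun x => f (- x)) e s -> alternates f e (map -%R s).
Proof. by elim: s e => //= x s IH e [ex /IH]. Qed.

(** Dividing by a root located between the first two points removes one sign
    change and one degree. *)
Lemma size_alternating_poly g e s :
  sorted <%R s -> alternates (horner g) e s -> (size s <= size g)%N.
Proof.
elim: s g e => //= x [|y s] IH g e.
  move=> _ [gx _]; rewrite lt0n size_poly_eq0.
  by apply: contraTneq gx => ->; rewrite horner0 mulr0 ltxx.
move=> /= /andP[xy sy] [gx [gy gs]].
have [|z] := @poly_ivtoo _ g x y (ltW xy); first by nra.
rewrite in_itv/= => /andP[xz zy] /factor_theorem[h gE].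
have h0 : h != 0.
  by apply: contraTneq gx => h0; rewrite gE h0 mul0r horner0 mulr0 ltxx.
rewrite gE size_Mmonic ?monicXsubC// size_XsubC addn2/= ltnS.
apply: (IH h (- e)) => //=.
have /allP zs : all (> z) (y :: s).
  rewrite /= zy/=; apply/allP => w ws.
  by apply: lt_trans zy _; have /allP := order_path_min lt_trans sy; apply.
have gs' : alternates (horner g) (- e) (y :: s) by [].
apply: alternates_ext gs' => w ws.
have := zs w ws; rewrite gE hornerM hornerXsubC => zw.
rewrite mulf_eq0 negb_or => /andP[hw _].
have : 0 < h.[w] ^+ 2 by rewrite exprn_even_gt0.
rewrite expr2; nra.
Qed.

(** A change of sign of [f] between consecutive points is itself a step up or
    down of [f]. *)
Lemma alternates_zigzag f e x s :
  alternates f e (x :: s) -> zigzag f (- e) x s.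
Proof.
elim: s e x => //= y s IH e x [ex [ey es]]; split; first by nra.
exact: (IH (- e)).
Qed.

(** The mean value theorem, applied on each step of the zigzag. *)
Lemma zigzag_deriv p e x s : path <%R x s -> zigzag (horner p) e x s ->
  exists u, [/\ size u = size s, path <%R x u & alternates (horner p^`()) e u].
Proof.
elim: s e x => [|y s IH] e x /=; first by exists [::].
move=> /andP[xy ys] [pxy /(IH _ _ ys)[u [us yu au]]].
have [z] := poly_mvt p xy; rewrite in_itv/= => /andP[xz zy] pE.
exists (z :: u); split => /=; first by rewrite us.
- rewrite xz/=; case: u yu {us au} => //= w u /andP[yw ->].
  by rewrite (lt_trans zy yw).
- split => //; move: pxy; rewrite pE; nra.
Qed.

Lemma alternates_catrev f e s t :
  alternates f e s -> alternates f (- e) t ->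
  exists e', alternates f e' (catrev s t).
Proof.
elim: s e t => [|x s IH] e t /=; first by move=> _ ?; exists (- e).
by move=> [ex es] et; apply: (IH (- e)) => //=; rewrite opprK.
Qed.

Lemma sorted_catrev_pivot x s t :
  path >%R x s -> path <%R x t -> sorted <%R (catrev s (x :: t)).
Proof.
elim: s x t => //= z s IH x t /andP[zx zs] xt.
by apply: IH => //=; rewrite zx.
Qed.

Lemma sorted_catrev x s t :
  path >%R x s -> path <%R x t -> sorted <%R (catrev s t).
Proof.
move=> xs xt; have := sorted_catrev_pivot xs xt; apply: (subseq_sorted lt_trans).
by rewrite !catrevE cat_subseq// subseq_cons.
Qed.

Lemma mulr_sign_trans (a b c : R) : 0 < a * b -> (0 < a * c) = (0 < b * c).
Proof.
case: (ltrgt0P a) => [a0|a0|->]; last by rewrite mul0r ltxx.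
  by rewrite !(pmulr_rgt0 _ a0) => b0; rewrite (pmulr_rgt0 _ b0).
by rewrite !(nmulr_rgt0 _ a0) => b0; rewrite (nmulr_rgt0 _ b0).
Qed.

(** The greedy choice behind Chebyshev's alternation theorem. One pass over the
    points [z :: s] extracts an alternating sublist [z :: t] and, placing a
    root between two consecutive points of opposite signs, a polynomial with
    the signs of [E] whose degree is the number [size t] of sign changes. As all
    its roots lie to the right of [z], it keeps the sign of [E z] on the left
    of [z]; this lets two such polynomials be multiplied. *)
Lemma sign_polynomial E z s :
  path <%R z s -> {in z :: s, forall w, E w != 0} ->
  exists t r, [/\ path <%R z t, alternates E (E z) (z :: t),
    (size r <= (size t).+1)%N, {in z :: s, forall w, 0 < r.[w] * E w}
    & forall x, x <= z -> 0 < r.[x] * E z].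
Proof.
elim: s z => [|y s IH] z.
  move=> _ /(_ z (mem_head _ _)) Ez.
  have EE : 0 < E z * E z by rewrite -expr2 exprn_even_gt0.
  exists [::], (E z)%:P; split => //=; first exact: size_polyC_leq1.
    by move=> w /[!inE] /eqP->; rewrite hornerC.
  by move=> x _; rewrite hornerC.
move=> /= /andP[zy ys] Es.
have Ez := Es z (mem_head _ _).
have Ey : E y != 0 by apply: Es; rewrite !inE eqxx orbT.
have [|t [r [yt Eyt sr rE rl]]] := IH y ys.
  by move=> w ws; apply: Es; rewrite in_cons ws orbT.
have EE : 0 < E z * E z by rewrite -expr2 exprn_even_gt0.
have EEy : 0 < E y * E y by rewrite -expr2 exprn_even_gt0.
case: (ltrgtP 0 (E z * E y)) => [zy0|zy0|/esym/eqP]; last first.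
- by rewrite mulf_eq0 (negPf Ez) (negPf Ey).
- have zy' : 0 < - E y * E z by rewrite mulNr oppr_gt0 mulrC.
  have rEz x : x <= z -> r.[x] * E z < 0.
    move=> xz; have := rl x (le_trans xz (ltW zy)).
    by rewrite mulrC -mulrNN (mulr_sign_trans _ zy') mulrN oppr_gt0 mulrC.
  (* the new root separates [z] from all the other points *)
  exists (y :: t), (r * ('X - ((z + y) / 2)%:P)); split.
  + by rewrite /= zy.
  + split => //.
    have c0 : 0 < - E z / E y.
      by rewrite -(pmulr_lgt0 _ EEy) mulrA divfK// mulNr oppr_gt0.
    by have := alternates_scale c0 Eyt; rewrite divfK.
  + by rewrite (leq_trans (size_polyMleq _ _))// size_XsubC addn2.
  + move=> w; rewrite hornerM hornerXsubC in_cons => /predU1P[->|ws].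
      by have := rEz z (lexx _); nra.
    have : y <= w.
      move: ws; rewrite in_cons => /predU1P[->//|ws].
      by have /allP/(_ w ws)/ltW := order_path_min lt_trans ys.
    have := rE w ws; nra.
  + move=> x xz; rewrite hornerM hornerXsubC.
    have := rEz x xz; nra.
- exists t, r; split => //.
  + by case: t yt {Eyt sr} => //= w t /andP[yw ->]; rewrite (lt_trans zy yw).
  + case: Eyt => _ Eyt; split => //.
    have c0 : 0 < E z / E y.
      by rewrite -(pmulr_lgt0 _ EEy) mulrA divfK.
    by have := alternates_scale c0 Eyt; rewrite mulrN divfK.
  + move=> w; rewrite in_cons => /predU1P[->|/rE//].
    by rewrite mulrC (mulr_sign_trans _ zy0) mulrC rl// ltW.
  + move=> x xz; rewrite mulrC (mulr_sign_trans _ zy0) mulrC.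
    exact: rl (le_trans xz (ltW zy)).
Qed.
End Alternation.

(** * The uniform distance to the sign function *)

Section SignError.
Variable R : realType.
Implicit Types (a b c x : R) (p q f r : {poly R}) (m : nat).

Lemma two_intervalsE a x :
  two_intervals a x <-> (a <= x <= 1 \/ a <= - x <= 1).
Proof.
rewrite /two_intervals /setU/= !in_itv/=; split=> -[]; [right|left|right|left];
  lra.
Qed.

Lemma sg_right a x : 0 < a -> a <= x -> Num.sg x = 1.
Proof. by move=> a0 ax; apply: gtr0_sg; apply: lt_le_trans ax. Qed.

Lemma sg_left a x : 0 < a -> a <= - x -> Num.sg x = -1.
Proof. by move=> a0 ax; apply: ltr0_sg; rewrite -oppr_gt0; apply: lt_le_trans ax. Qed.

Lemma sgn_error_has_ubound a p : 0 < a ->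
  has_ubound [set `|p.[x] - Num.sg x| | x in two_intervals a].
Proof.
move=> a0; have [M pM] := poly_itv_bound p (-1) 1.
exists (M + 1) => _ [x /two_intervalsE ax <-].
rewrite (le_trans (ler_normB _ _))// lerD//; first by apply: pM; case: ax; lra.
by rewrite normr_sg; case: eqP.
Qed.

Lemma sgn_error_right a p x : 0 < a -> a <= x <= 1 ->
  `|p.[x] - 1| <= sgn_error a p.
Proof.
move=> a0 ax; rewrite -(@sg_right a x) //; last by case/andP: ax.
by apply: (ub_le_sup (sgn_error_has_ubound p a0)); exists x => //; apply/two_intervalsE; left.
Qed.

Lemma sgn_error_left a p x : 0 < a -> a <= x <= 1 ->
  `|p.[- x] + 1| <= sgn_error a p.
Proof.
move=> a0 ax; rewrite -[1]opprK -(@sg_left a (- x)) ?opprK//; last by case/andP: ax.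
apply: (ub_le_sup (sgn_error_has_ubound p a0)); exists (- x) => //.
by apply/two_intervalsE; right; rewrite opprK.
Qed.

Lemma sgn_error_le a p c : 0 < a <= 1 ->
  (forall x, a <= x <= 1 -> `|p.[x] - 1| <= c) ->
  (forall x, a <= x <= 1 -> `|p.[- x] + 1| <= c) -> sgn_error a p <= c.
Proof.
move=> /andP[a0 a1] pr pl; apply: ge_sup.
  exists `|p.[1] - Num.sg 1|; exists 1 => //; apply/two_intervalsE; left; lra.
move=> _ [x /two_intervalsE[] ax <-].
  by rewrite (@sg_right a)//; [exact: pr|case/andP: ax].
rewrite (@sg_left a)//; last by case/andP: ax.
by rewrite opprK -[x]opprK; exact: pl.
Qed.

Lemma sgn_error_ge0 a p : 0 < a <= 1 -> 0 <= sgn_error a p.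
Proof.
move=> /andP[a0 a1]; apply: le_trans (sgn_error_right p a0 (x := 1) _) => //; lra.
Qed.

Lemma sgn_error_antitone a b p : 0 < a -> a <= b <= 1 ->
  sgn_error b p <= sgn_error a p.
Proof.
move=> a0 ab; apply: sgn_error_le => [|x xb|x xb]; first lra.
  by apply: sgn_error_right => //; lra.
by apply: sgn_error_left => //; lra.
Qed.

Lemma best_sgn_errorE m a p : 0 < a <= 1 -> best_sgn_approx m a p ->
  best_sgn_error m a = sgn_error a p.
Proof.
move=> a01 [pm pbest]; apply/le_anti/andP; split.
  apply: ge_inf; last by exists p.
  by exists 0 => _ [q _ <-]; apply: sgn_error_ge0.
apply: lb_le_inf; first by exists (sgn_error a p), p.
by move=> _ [q qm <-]; apply: pbest.
Qed.

Lemma horner_compN p x : (p \Po - 'X).[x] = p.[- x].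
Proof. by rewrite horner_comp hornerN hornerX. Qed.

(** The symmetry [x |-> - x] of the problem, under which the sign function is
    invariant. *)
Definition flip p := - (p \Po - 'X).

Lemma horner_flip p x : (flip p).[x] = - p.[- x].
Proof. by rewrite /flip hornerN horner_comp hornerN hornerX. Qed.

Lemma size_compN p : size (p \Po - 'X) = size p.
Proof.
by rewrite size_comp_poly2// size_polyN size_polyX.
Qed.

Lemma admissible_flip m p : admissible m p -> admissible m (flip p).
Proof. by rewrite /admissible /= /flip size_polyN size_compN. Qed.

Lemma best_sgn_approx_flip m a p : 0 < a <= 1 ->
  best_sgn_approx m a p -> best_sgn_approx m a (flip p).
Proof.
move=> a01 [pm pbest]; split; first exact: admissible_flip.
move=> q /pbest; apply: le_trans; apply: sgn_error_le => // x ax.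
  rewrite horner_flip -opprD normrN; apply: sgn_error_left => //; lra.
rewrite horner_flip opprK addrC -opprB normrN; apply: sgn_error_right => //; lra.
Qed.

(** If [r] has the sign of [f] wherever |f| reaches its bound [L], then
    [f - e r] has norm smaller than [L] for all small [e]. By compactness
    [max (L - |f|) (r f)] is bounded below by some [d > 0]: at each point either
    there is room [d] below [L], or expanding the square of [f - e r] gains
    [2 e d] against a loss of at most [e^2 M^2 <= e d]. *)
Lemma strict_improvement f r b c L : b <= c -> 0 < L ->
  (forall x, b <= x <= c -> `|f.[x]| <= L) ->
  (forall x, b <= x <= c -> `|f.[x]| = L -> 0 < r.[x] * f.[x]) ->
  exists2 e0, 0 < e0 & forall e, 0 < e <= e0 ->
    exists2 L', L' < L & forall x, b <= x <= c -> `|f.[x] - e * r.[x]| <= L'.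
Proof.
move=> bc L0 fL rf.
have cp (g : {poly R}) : {within `[b, c], continuous (horner g)}.
  by apply: continuous_subspaceT => x; exact: continuous_horner.
have cn (g : {poly R}) : {within `[b, c], continuous (fun x => `|g.[x]|)}.
  by apply: continuous_subspaceT => x; apply: continuous_comp;
    [exact: continuous_horner|exact: norm_continuous].
pose phi x := Num.max (L - `|f.[x]|) (r.[x] * f.[x]).
have [|z zbc phiz] := @EVT_min R phi b c bc.
  have -> : phi = (fun x => (L - `|f.[x]| + r.[x] * f.[x] +
      `|L - `|f.[x]| - r.[x] * f.[x]|) / 2).
    by apply/funext => x; rewrite /phi maxr_absE.
  have cu : continuous (fun x => L - `|f.[x]|).
    move=> x; apply: cvgB; first exact: cvg_cst.
    by apply: cvg_norm; exact: continuous_horner.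
  have cv : continuous (fun x => r.[x] * f.[x]).
    by move=> x; apply: cvgM; exact: continuous_horner.
  apply: continuous_subspaceT => x; apply: cvgM; last exact: cvg_cst.
  apply: cvgD; first by apply: cvgD; [exact: cu|exact: cv].
  by apply: cvg_norm; apply: cvgB; [exact: cu|exact: cv].
move: zbc; rewrite in_itv/= => zbc.
have phi0 : 0 < phi z.
  rewrite /phi lt_max subr_gt0; have := fL z zbc; rewrite le_eqVlt => /predU1P[fz|->//].
  by rewrite rf// orbT.
have [M0 rM0] := poly_itv_bound r b c.
pose M := `|M0| + 1.
have M0' : 0 < M by rewrite /M ltr_wpDl.
have rM x : b <= x <= c -> `|r.[x]| < M.
  move=> /rM0 h; rewrite (le_lt_trans h)// /M (le_lt_trans (ler_norm _))//.
  by rewrite ltrDl.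
pose d := phi z.
exists (Num.min (d / M) (d / M ^+ 2)).
  by rewrite lt_min !divr_gt0 ?exprn_gt0.
move=> e /andP[e0]; rewrite le_min !ler_pdivlMr ?exprn_gt0// => /andP[eM eM2].
have [t tbc tmax] := EVT_max bc (cn (f - e *: r)).
exists `|(f - e *: r).[t]|; last first.
  move=> x xbc; have := tmax x; rewrite in_itv/= !hornerE; exact.
move: tbc; rewrite in_itv/= => tbc.
have := phiz t; rewrite in_itv/= -/d => /(_ tbc).
rewrite !hornerE le_max => /orP[dt|dt].
  have := rM t tbc => rtM.
  rewrite (le_lt_trans (ler_normB _ _))// normrM (gtr0_norm e0).
  nra.
have := fL t tbc; have := rM t tbc; rewrite -/(is_true _).
move=> rtM ftL; rewrite -ltr_sqr ?nnegrE ?(ltW L0)//.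
have f2 : f.[t] ^+ 2 <= L ^+ 2 by rewrite -real_normK ?num_real// ler_sqr ?nnegrE ?(ltW L0).
have r2 : r.[t] ^+ 2 < M ^+ 2 by rewrite -real_normK ?num_real// ltr_sqr ?nnegrE ?(ltW M0').
rewrite real_normK ?num_real//.
have -> : (f.[t] - e * r.[t]) ^+ 2 =
  f.[t] ^+ 2 - 2 * e * (r.[t] * f.[t]) + e * (e * r.[t] ^+ 2) by ring.
have h1 : e * r.[t] ^+ 2 <= d by rewrite (le_trans _ eM2)// ler_pM2l// ltW.
have h2 : e * (e * r.[t] ^+ 2) <= e * d by rewrite ler_pM2l.
have h3 : e * d <= e * (r.[t] * f.[t]) by rewrite ler_pM2l.
have h4 : 0 < e * d by rewrite mulr_gt0.
lra.
Qed.
End SignError.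

(** * Best approximations on the gap, and the Levy distance *)

Section GapBound.
Variable R : realType.
Implicit Types (a b c x : R) (p q f r : {poly R}) (m : nat).

(** The extremal points are finite in number, being roots of
    [(f - L) (f + L)]. *)
Lemma extremal_points f b c (L : R) : (1 < size f)%N -> 0 <= L ->
  exists2 s, sorted <%R s &
    forall x, (x \in s) = (b <= x <= c) && (`|f.[x]| == L).
Proof.
move=> sf L0; pose g := (f - L%:P) * (f + L%:P).
have g0 : g != 0.
  have szL (u : R) : size (f + u%:P) = size f.
    by rewrite size_polyDl// (leq_ltn_trans (size_polyC_leq1 _)).
  by rewrite mulf_eq0 negb_or -!size_poly_gt0 -polyCN !szL (ltn_trans _ sf).
exists [seq x <- rootsR g | b <= x <= c].
  by apply: sorted_filter; [exact: lt_trans|exact: sorted_roots].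
move=> x; rewrite mem_filter -roots_on_rootsR// in_itv/=; congr andb.
by rewrite rootM !rootE !hornerE subr_eq0 addr_eq0 eqr_norml L0 andbT.
Qed.

(** Both halves of the interval are described from [x0] outwards, the left one
    through [p (- x)], so that [sign_polynomial] applies to each with the sign
    at [x0] positive. The two alternating lists share only [x0]; together they
    are a single zigzag of [p], because [p - 1] and [p + 1] are both positive
    at [x0]. *)
Lemma best_approx_le1_on_gap m a p x0 : 0 < a < 1 -> best_sgn_approx m a p ->
  0 < sgn_error a p < 1 -> - a < x0 < a -> p.[x0] <= 1.
Proof.
move=> /andP[a0 a1] [pm pbest]; set L := sgn_error a p => /andP[L0 L1] /andP[ax0 x0a].
rewrite leNgt; apply/negP => px0.
have a01 : 0 < a <= 1 by rewrite a0 ltW.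
(* a constant larger than 1 is at distance more than 2 from -1 *)
have sp : (1 < size p)%N.
  rewrite ltnNge; apply/negP => /size1_polyC pE.
  have := sgn_error_left p a0 (x := a); rewrite lexx ltW// -/L => /(_ isT).
  move: px0; rewrite pE !hornerC ler_norml; lra.
pose fR := p - 1; pose fL := p \Po - 'X + 1.
have size1 : size (1 : {poly R}) = 1%N by rewrite size_poly1.
have sfR : (1 < size fR)%N by rewrite size_polyDl// size_polyN size1.
have sfL : (1 < size fL)%N by rewrite size_polyDl ?size_compN// size1.
have fRE x : fR.[x] = p.[x] - 1 by rewrite !hornerE.
have fLE x : fL.[x] = p.[- x] + 1 by rewrite hornerD horner_compN hornerE.
have [sR sRs sRP] := extremal_points a 1 sfR (ltW L0).
have [sL sLs sLP] := extremal_points a 1 sfL (ltW L0).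
have pathR : path <%R x0 sR.
  rewrite path_min_sorted//; apply/allP => x; rewrite sRP => /andP[/andP[ax _] _].
  exact: lt_le_trans ax.
have pathL : path <%R (- x0) sL.
  rewrite path_min_sorted//; apply/allP => x; rewrite sLP => /andP[/andP[ax _] _].
  by apply: lt_le_trans ax; rewrite ltrNl.
have fRx0 : 0 < fR.[x0] by rewrite fRE subr_gt0.
have fLx0 : 0 < fL.[- x0] by rewrite fLE opprK; lra.
have [|tR [rR [ptR atR srR rRs rRl]]] := @sign_polynomial R (horner fR) _ _ pathR.
  move=> w; rewrite in_cons => /predU1P[->|]; first by rewrite gt_eqF.
  by rewrite sRP -normr_eq0 => /andP[_ /eqP->]; rewrite gt_eqF.
have [|tL [rL [ptL atL srL rLs rLl]]] := @sign_polynomial R (horner fL) _ _ pathL.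
  move=> w; rewrite in_cons => /predU1P[->|]; first by rewrite gt_eqF.
  by rewrite sLP -normr_eq0 => /andP[_ /eqP->]; rewrite gt_eqF.
have rRpos x : x <= x0 -> 0 < rR.[x] by move=> /rRl; rewrite pmulr_lgt0.
have rLpos x : x <= - x0 -> 0 < rL.[x] by move=> /rLl; rewrite pmulr_lgt0.
have [small|large] := leqP (size tR + size tL) (2 * m + 1).
(* few sign changes: a small multiple of [r] can be subtracted from [p] *)
- pose r := rR * (rL \Po - 'X).
  have [||eR eR0 improveR] := @strict_improvement _ fR r a 1 L (ltW a1) L0.
  + by move=> x ax; rewrite fRE; exact: sgn_error_right.
  + move=> x ax /eqP fx; rewrite hornerM horner_compN mulrAC.
    apply: mulr_gt0; first by apply: rRs; rewrite in_cons sRP ax fx orbT.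
    by apply: rLpos; rewrite lerN2; case/andP: ax => /(lt_le_trans x0a)/ltW.
  have [||eL eL0 improveL] := @strict_improvement _ fL (r \Po - 'X) a 1 L (ltW a1) L0.
  + by move=> x ax; rewrite fLE; exact: sgn_error_left.
  + move=> x ax /eqP fx; rewrite horner_compN hornerM horner_compN opprK -mulrA.
    apply: mulr_gt0; last by apply: rLs; rewrite in_cons sLP ax fx orbT.
    by apply: rRpos; case/andP: ax => ax _; lra.
  pose e := Num.min eR eL.
  have e0 : 0 < e by rewrite lt_min eR0.
  have [|LR LRL qR] := improveR e; first by rewrite e0 ge_min lexx.
  have [|LL LLL qL] := improveL e; first by rewrite e0 ge_min lexx orbT.
  have qm : admissible m (p - e *: r).
    rewrite /admissible/= (leq_trans (size_polyD _ _))// geq_max pm/= size_polyN.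
    rewrite (leq_trans (size_scale_leq _ _))// (leq_trans (size_polyMleq _ _))//.
    rewrite size_compN -subn1 leq_subLR (leq_trans (leq_add srR srL))//.
    by rewrite addnS addSn add1n !ltnS.
  have := pbest _ qm; rewrite leNgt => /negP; apply.
  apply: (@le_lt_trans _ _ (Num.max LR LL)); last by rewrite gt_max LRL.
  apply: sgn_error_le => // x ax; rewrite le_max; apply/orP; [left|right].
    by have := qR x ax; rewrite fRE !hornerE addrAC.
  by have := qL x ax; rewrite fLE horner_compN !hornerE addrAC.
(* many sign changes: [p^`()] alternates on too many points *)
- have [uR [suR puR auR]] := zigzag_deriv ptR (alternates_zigzag atR).
  have [uL [suL puL auL]] := zigzag_deriv ptL (alternates_zigzag atL).
  have aR : alternates (horner p^`()) (- 1) uR.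
    apply: (alternates_unscale fRx0); rewrite mulrN1.
    by move: auR; rewrite derivB derivC subr0.
  have aL : alternates (horner p^`()) 1 (map -%R uL).
    apply: alternates_map_opp; apply: (alternates_unscale fLx0); rewrite mulr1.
    have := alternates_opp auL; congr alternates; apply/funext => x.
    by rewrite derivD derivC addr0 deriv_comp derivN derivX hornerM !hornerE
      horner_compN mulrN1 opprK.
  have [e alt] := alternates_catrev aL aR.
  have sorted_u : sorted <%R (catrev (map -%R uL) uR).
    apply: (@sorted_catrev _ x0) => //.
    rewrite -[x0]opprK path_map; move: puL; congr is_true; apply: eq_path.
    by move=> y z; rewrite /= ltrN2.
  have := size_alternating_poly sorted_u alt.
  rewrite catrevE size_cat size_rev size_map suR suL addnC => le1.
  have p0 : p != 0 by rewrite -size_poly_gt0 (ltn_trans _ sp).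
  have := leq_trans (lt_size_deriv p0) pm.
  by rewrite ltnS => /(leq_trans le1); rewrite leqNgt large.
Qed.

Lemma best_approx_abs_le1_on_gap m a p x : 0 < a < 1 -> best_sgn_approx m a p ->
  0 < sgn_error a p < 1 -> - a < x < a -> `|p.[x]| <= 1.
Proof.
move=> a01 pbest L01 xa; rewrite ler_norml (best_approx_le1_on_gap a01 pbest L01 xa).
have a01' : 0 < a <= 1 by case/andP: a01 => -> /ltW.
have fbest := best_sgn_approx_flip a01' pbest.
have fL : sgn_error a (flip p) = sgn_error a p.
  by rewrite -(best_sgn_errorE a01' pbest) -(best_sgn_errorE a01' fbest).
rewrite -[x in p.[x]]opprK -lerN2 -horner_flip opprK andbT.
rewrite -fL in L01; apply: best_approx_le1_on_gap a01 fbest L01 _; lra.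
Qed.

(** The error over the smaller gap [(-b, b)], with [h < b < a], is at most [h]
    when [h] is feasible, and at least [a]. *)
Lemma levy_dist_best_approx m a p : 0 < a < 1 -> best_sgn_approx m a p ->
  sgn_error a p = a -> levy_dist Num.sg (fun x => p.[x]) = a.
Proof.
move=> a01 pbest La; have /andP[a0 a1] := a01.
have L01 : 0 < sgn_error a p < 1 by rewrite La.
have sg1 (y : R) : -1 <= Num.sg y <= 1 by case: sgrP => _; lra.
rewrite /levy_dist; set S := [set h | _]; have aS : S a.
  split; first exact: ltW.
  move=> x x11; have := sg1 (x - a); have := sg1 (x + a).
  have [ax|xa] := leP a x.
    rewrite (gtr0_sg (x := x + a)); last lra.
    have := sgn_error_right p a0 (x := x); rewrite La ler_norml.
    by move=> /(_ ltac:(lra)); lra.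
  have [xNa|ax] := leP x (- a).
    rewrite (ltr0_sg (x := x - a)); last lra.
    have := sgn_error_left p a0 (x := - x); rewrite La opprK ler_norml.
    by move=> /(_ ltac:(lra)); lra.
  rewrite (ltr0_sg (x := x - a)) ?(gtr0_sg (x := x + a)); [|lra|lra].
  have := best_approx_abs_le1_on_gap a01 pbest L01 (x := x); rewrite ler_norml.
  by move=> /(_ ltac:(lra)); lra.
apply/le_anti/andP; split; first by apply: ge_inf aS; exists 0 => h [].
apply: lb_le_inf; first by exists a.
move=> h [h0 hp]; rewrite leNgt; apply/negP => ha.
pose b := (h + a) / 2.
have ab : sgn_error a p <= sgn_error b p by apply: sgn_error_antitone; rewrite /b; lra.
have : sgn_error b p <= h; last by lra.
apply: sgn_error_le => [|x bx|x bx]; first by rewrite /b; lra.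
  have := hp x ltac:(rewrite /b in bx; lra).
  rewrite (gtr0_sg (x := x - h)) ?(gtr0_sg (x := x + h)) ?ler_norml;
    rewrite /b in bx; lra.
have := hp (- x) ltac:(rewrite /b in bx; lra).
rewrite (ltr0_sg (x := - x - h)) ?(ltr0_sg (x := - x + h)) ?ler_norml;
  rewrite /b in bx; lra.
Qed.
End GapBound.

(** * Chebyshev polynomials of an interval *)

Section Chebyshev.
Variable R : realType.
Implicit Types (A B M x y z : R) (Q : {poly R}) (m n : nat).

Fixpoint chebyshev n : {poly R} :=
  match n with
  | 0 => 1
  | S n' => if n' is S n'' then 2%:R *: 'X * chebyshev n' - chebyshev n'' else 'X
  end.

Lemma horner_chebyshevSS n x : (chebyshev n.+2).[x] =
  2 * x * (chebyshev n.+1).[x] - (chebyshev n).[x].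
Proof. by rewrite /= -/(chebyshev n.+1) !hornerE. Qed.

Lemma chebyshev_ind2 (P : nat -> Prop) :
  P 0 -> P 1 -> (forall n, P n -> P n.+1 -> P n.+2) -> forall n, P n.
Proof.
move=> P0 P1 PS n; suff [] : P n /\ P n.+1 by [].
by elim: n => // n [Pn Pn1]; split=> //; apply: PS.
Qed.

Lemma size_chebyshev n : (size (chebyshev n) <= n.+1)%N.
Proof.
elim/chebyshev_ind2: n => [||n IH0 IH1]; rewrite ?size_poly1 ?size_polyX//.
rewrite /= -/(chebyshev n.+1) (leq_trans (size_polyD _ _))// size_polyN geq_max.
apply/andP; split; last by rewrite (leq_trans IH0)// -[n.+3]addn2 leq_addr.
rewrite -scalerAl (leq_trans (size_scale_leq _ _))//.
by rewrite mulrC (leq_trans (size_polyMleq _ _))// size_polyX addn2.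
Qed.

Lemma chebyshev_cos n x : (chebyshev n).[cos x] = cos (n%:R * x).
Proof.
elim/chebyshev_ind2: n => [||n IH0 IH1]; first by rewrite hornerC mul0r cos0.
  by rewrite hornerX mul1r.
rewrite horner_chebyshevSS IH0 IH1.
have -> : n.+2%:R * x = n.+1%:R * x + x by rewrite -[n.+2]addn1 natrD; ring.
have -> : n%:R * x = n.+1%:R * x - x by rewrite -[n.+1]addn1 natrD; ring.
by rewrite (cosB _ x) (cosD _ x); ring.
Qed.

(** With [z = expR t] this is T_n (cosh t) = cosh (n t). *)
Lemma chebyshev_joukowski n z : z != 0 ->
  (chebyshev n).[(z + z^-1) / 2] = (z ^+ n + z^-1 ^+ n) / 2.
Proof.
move=> z0; elim/chebyshev_ind2: n => [||n IH0 IH1]; rewrite ?hornerC ?hornerX.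
- by rewrite !expr0; field.
- by rewrite !expr1.
rewrite horner_chebyshevSS IH0 IH1 !exprS.
move: (z ^+ n) (z^-1 ^+ n) => u v; field; exact: z0.
Qed.

Lemma chebyshev_norm_le1 n x : -1 <= x <= 1 -> `|(chebyshev n).[x]| <= 1.
Proof.
by move=> x1; rewrite -(acosK x1) chebyshev_cos ler_norml cos_geN1 cos_le1.
Qed.

(** The induction also carries the monotonicity of T_(n+1) - T_n, which
    satisfies D_(n+1) x = 2 (x - 1) T_(n+1) x + D_n x. *)
Lemma chebyshev_mono n x y : 1 <= x -> x <= y ->
  1 <= (chebyshev n).[x] <= (chebyshev n).[y].
Proof.
move=> x1 xy.
suff [] : 1 <= (chebyshev n).[x] <= (chebyshev n).[y] /\
  0 <= (chebyshev n.+1).[x] - (chebyshev n).[x] <=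
  (chebyshev n.+1).[y] - (chebyshev n).[y] by [].
elim: n => [|n [/andP[a1 a2] /andP[b1 b2]]]; first by rewrite !hornerE; lra.
have c1 : 1 <= (chebyshev n.+1).[x] by lra.
have c2 : (chebyshev n.+1).[x] <= (chebyshev n.+1).[y] by lra.
split; first by rewrite c1 c2.
have DE w : (chebyshev n.+2).[w] - (chebyshev n.+1).[w] =
  2 * (w - 1) * (chebyshev n.+1).[w] + ((chebyshev n.+1).[w] - (chebyshev n).[w]).
  by rewrite horner_chebyshevSS; ring.
rewrite !DE; apply/andP; split; first by nra.
by apply: lerD => //; apply: ler_pM; nra.
Qed.

Lemma cos_natpi n : cos (n%:R * pi) = (- 1) ^+ n :> R.
Proof.
elim: n => [|n IH]; first by rewrite mul0r cos0 expr0.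
by rewrite -natr1 mulrDl mul1r cosDpi IH exprS mulN1r.
Qed.

(** The affine change of variable reverses the order: it sends [A] to 1 and [B]
    to -1, so that points to the left of [A] go to [1, +oo). *)
Definition chebyshev_on A B n : {poly R} :=
  chebyshev n \Po (((A + B) / (B - A))%:P - (2 / (B - A)) *: 'X).

Lemma horner_chebyshev_on A B n y :
  (chebyshev_on A B n).[y] = (chebyshev n).[(A + B - 2 * y) / (B - A)].
Proof. by rewrite horner_comp !hornerE; congr horner; ring. Qed.

Lemma size_chebyshev_on A B n : (size (chebyshev_on A B n) <= n.+1)%N.
Proof.
rewrite (leq_trans (size_comp_poly_leq _ _))//.
set l := (X in (_ * (size X).-1)%N).
have sl : (size l <= 2)%N.
  rewrite /l (leq_trans (size_polyD _ _))// geq_max size_polyN.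
  rewrite (leq_trans (size_polyC_leq1 _))//=.
  by rewrite (leq_trans (size_scale_leq _ _))// size_polyX.
rewrite ltnS -[leqRHS]muln1 leq_mul//; last by case: (size l) sl.
by have := size_chebyshev n; case: (size (chebyshev n)).
Qed.

Lemma alternates_iota (f : R -> R) (t : nat -> R) k n :
  (forall j, (k <= j < k + n)%N -> 0 < (- 1) ^+ j * f (t j)) ->
  alternates f ((- 1) ^+ k) [seq t j | j <- iota k n].
Proof.
elim: n k => //= n IH k ft; split; first by apply: ft; rewrite leqnn addnS ltnS leq_addr.
have -> : - (- 1) ^+ k = (- 1) ^+ k.+1 :> R by rewrite exprS mulN1r.
apply: IH => j /andP[kj jn].
by apply: ft; rewrite (ltnW kj) addnS -addSn jn.
Qed.

(** Otherwise [T - c Q], for a constant [c] with |c| M < 1 chosen so that the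
    sign at [y0] becomes negative, alternates on [y0] followed by the m+1
    extremal points of [T], which is too much for its degree. *)
Lemma chebyshev_growth m A B M Q y0 : A < B -> 0 < M -> (size Q <= m.+1)%N ->
  (forall y, A <= y <= B -> `|Q.[y]| <= M) -> y0 < A ->
  `|Q.[y0]| <= M * (chebyshev_on A B m).[y0].
Proof.
move=> AB M0 sQ QM y0A; rewrite leNgt; apply/negP.
set T := chebyshev_on A B m => big.
have BA0 : 0 < B - A by rewrite subr_gt0.
have T1 : 1 <= T.[y0].
  rewrite horner_chebyshev_on.
  have [|] := andP (@chebyshev_mono m 1 ((A + B - 2 * y0) / (B - A)) (lexx _) _) => //.
    by rewrite ler_pdivlMr//; lra.
  exact: le_trans.
have Q0 : 0 < `|Q.[y0]| by apply: lt_trans big; rewrite mulr_gt0//; lra.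
(* any number strictly between T y0 / |Q y0| and 1 / M *)
pose c := (T.[y0] / `|Q.[y0]| + M^-1) / 2.
have cM : c * M < 1.
  have : T.[y0] / `|Q.[y0]| * M < 1 by rewrite mulrAC ltr_pdivrMr// mul1r mulrC.
  have : M^-1 * M = 1 by rewrite mulVf// gt_eqF.
  rewrite /c; lra.
have cQ : T.[y0] < c * `|Q.[y0]|.
  have : T.[y0] / `|Q.[y0]| * `|Q.[y0]| = T.[y0] by rewrite divfK// gt_eqF.
  have : T.[y0] < M^-1 * `|Q.[y0]| by rewrite mulrC ltr_pdivlMr// mulrC.
  rewrite /c; lra.
have c0 : 0 < c by rewrite /c divr_gt0// addr_gt0 ?divr_gt0 ?invr_gt0//; lra.
clearbody c.
pose g := T - (c * Num.sg Q.[y0]) *: Q.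
pose node j : R := ((A + B) - (B - A) * cos (j%:R * (pi / m%:R))) / 2.
have angle j : (j <= m)%N -> j%:R * (pi / m%:R) \in `[0, pi :> R].
  move=> jm; rewrite in_itv/= mulr_ge0 ?divr_ge0 ?pi_ge0//=.
  have [->|m0] := posnP m; first by rewrite invr0 !mulr0 pi_ge0.
  rewrite mulrCA ger_pMr ?pi_gt0//.
  by rewrite ler_pdivrMr ?ltr0n// mul1r ler_nat.
have nodeAB j : A <= node j <= B.
  have := cos_le1 (j%:R * (pi / m%:R) : R); have := cos_geN1 (j%:R * (pi / m%:R) : R).
  rewrite /node; move: (cos _) => w w1 w2; apply/andP; split; nra.
have nodeT j : (j <= m)%N -> T.[node j] = (- 1) ^+ j.
  move=> jm; rewrite horner_chebyshev_on.
  have -> : (A + B - 2 * node j) / (B - A) = cos (j%:R * (pi / m%:R)).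
    by rewrite /node; field; rewrite gt_eqF.
  rewrite chebyshev_cos -cos_natpi; congr cos.
  have [m0|m0] := posnP m; last by field; rewrite pnatr_eq0 -lt0n.
  by move: jm; rewrite m0 leqn0 => /eqP->; rewrite !mul0r.
have node_lt i j : (i < j <= m)%N -> node i < node j.
  move=> /andP[ij jm].
  have : cos (j%:R * (pi / m%:R)) < cos (i%:R * (pi / m%:R) : R).
    rewrite ltr_cos ?angle ?(leq_trans (ltnW ij))//.
    rewrite ltr_pM2r ?ltr_nat// divr_gt0 ?pi_gt0// ltr0n.
    by rewrite (leq_trans _ jm)// (leq_trans _ ij).
  by rewrite /node; nra.
have sg_g j : (j <= m)%N -> 0 < (- 1) ^+ j * g.[node j].
  move=> jm; rewrite !hornerE nodeT// mulrBr -expr2 sqrr_sign subr_gt0.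
  rewrite (le_lt_trans (ler_norm _))// !normrM normr_sign mul1r normr_sg.
  move: Q0; rewrite normr_gt0 => ->.
  rewrite mulr1 (gtr0_norm c0) (le_lt_trans _ cM)// ler_pM2l//.
  exact: QM.
have alt : alternates (horner g) (- 1) (y0 :: [seq node j | j <- iota 0 m.+1]).
  split; last first.
    rewrite opprK -(expr0 (- 1)); apply: alternates_iota => j.
    by rewrite ltnS => /= /sg_g.
  rewrite !hornerE mulN1r opprB subr_gt0 -mulrA -normrEsg; exact: cQ.
have srt : path <%R y0 [seq node j | j <- iota 0 m.+1].
  rewrite path_min_sorted.
    apply: (homo_sorted_in (P := [pred j | (j <= m)%N])) (iota_ltn_sorted 0 m.+1).
      by move=> i j _ /= jm ij; apply: node_lt; rewrite ij.
    by apply/allP => j; rewrite mem_iota.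
  by apply/allP => _ /mapP[j _ ->]; apply: lt_le_trans y0A _; case/andP: (nodeAB j).
have := @size_alternating_poly R g _ (y0 :: _) srt alt; rewrite /= size_map size_iota.
apply/negP; rewrite -leqNgt (leq_trans (size_polyD _ _))// geq_max size_polyN.
by rewrite size_chebyshev_on (leq_trans (size_scale_leq _ _)).
Qed.
End Chebyshev.

(** * Lower bound for the error *)

Section LowerBound.
Variable R : realType.
Implicit Types (a d x y z : R) (p : {poly R}) (m n N : nat).

(** For an interval with endpoints the squares of [al] and [be], the point 0
    corresponds to (z + z^-1)/2 with z = (be + al)/(be - al). *)
Lemma chebyshev_on_at0 (al be : R) n : 0 <= al < be ->
  (chebyshev_on (al ^+ 2) (be ^+ 2) n).[0] =
  (((be + al) / (be - al)) ^+ n + ((be + al) / (be - al))^-1 ^+ n) / 2.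
Proof.
move=> /andP[al0 ab].
have bma : be - al != 0 by rewrite subr_eq0 gt_eqF.
have bpa : be + al != 0 by rewrite gt_eqF//; lra.
rewrite horner_chebyshev_on -chebyshev_joukowski ?mulf_neq0 ?invr_eq0//.
congr horner; field.
by rewrite bma bpa subr_sqr mulf_neq0.
Qed.

Lemma chebyshev_on_antitone A B n y y' : A < B -> y <= y' -> y' <= A ->
  1 <= (chebyshev_on A B n).[y'] <= (chebyshev_on A B n).[y].
Proof.
move=> AB yy' yA; have BA : 0 < B - A by rewrite subr_gt0.
rewrite !horner_chebyshev_on; apply: chebyshev_mono.
  by rewrite ler_pdivlMr//; lra.
by rewrite ler_pM2r ?invr_gt0//; lra.
Qed.

Lemma horner_even_poly p x : (even_poly p).[x ^+ 2] = (p.[x] + p.[- x]) / 2.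
Proof.
have pE y : p.[y] = (even_poly p).[y ^+ 2] + (odd_poly p).[y ^+ 2] * y.
  by rewrite -[in LHS](poly_even_odd p) hornerD hornerM !horner_comp hornerXn hornerX.
by rewrite !pE sqrrN; field.
Qed.

(** The step [a / N] trades a loss of a factor [N], harmless on the logarithmic
    scale, against a widening of the gap from [a] to [a + a / N]. *)
Lemma sgn_error_lower_bound m a p N (al be : R) :
  (0 < N)%N -> 0 < a -> admissible m p -> 0 < sgn_error a p ->
  al = a + a / N%:R -> be = 1 - a / N%:R -> al < be ->
  1 <= sgn_error a p * (1 + N%:R * ((be + al) / (be - al)) ^+ m).
Proof.
move=> N0 a0 pm L0; set L := sgn_error a p.
set d := a / N%:R => alE beE ab.
have N0' : 0 < N%:R :> R by rewrite ltr0n.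
have d0 : 0 < d by rewrite divr_gt0.
have dN : N%:R * d = a by rewrite mulrC divfK// gt_eqF.
have al0 : 0 < al by rewrite alE addr_gt0.
pose z := (be + al) / (be - al); rewrite -/z.
have z1 : 1 <= z by rewrite ler_pdivlMr ?subr_gt0//; lra.
pose K : {poly R} := (p \Po ('X + d%:P)) - (p \Po ('X - d%:P)).
have KE x : K.[x] = p.[x + d] - p.[x - d].
  by rewrite /K hornerD hornerN !horner_comp !hornerE.
pose E := even_poly K.
have sE : (size E <= m.+1)%N.
  rewrite (leq_trans (size_even_poly _))//.
  have : (size K <= (2 * m + 1).+1)%N.
    rewrite (leq_trans (size_polyD _ _))// size_polyN.
    by rewrite !size_comp_poly2 ?maxnn ?size_XsubC ?size_XaddC.
  by move=> sK; rewrite (leq_trans (uphalf_leq sK))// addn1 mul2n -doubleS uphalf_double.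
have EB y : al ^+ 2 <= y <= be ^+ 2 -> `|E.[y]| <= 2 * L.
  move=> /andP[ay yb].
  have y0 : 0 <= y by rewrite (le_trans _ ay)// sqr_ge0.
  have -> : y = Num.sqrt y ^+ 2 by rewrite sqr_sqrtr.
  have al_x : al <= Num.sqrt y by rewrite -(ger0_norm (ltW al0)) -sqrtr_sqr ler_sqrt.
  have x_be : Num.sqrt y <= be.
    by rewrite -(ger0_norm (ltW (lt_trans al0 ab))) -sqrtr_sqr ler_sqrt ?sqr_ge0.
  move: (Num.sqrt y) al_x x_be => x al_x x_be.
  have [ax xb] : a <= x - d /\ x + d <= 1 by split; lra.
  rewrite /E horner_even_poly !KE.
  have := sgn_error_right p a0 (x := x + d) ltac:(lra).
  have := sgn_error_right p a0 (x := x - d) ltac:(lra).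
  have := sgn_error_left p a0 (x := x + d) ltac:(lra).
  have := sgn_error_left p a0 (x := x - d) ltac:(lra).
  rewrite -/L !opprD !opprK !ler_norml; lra.
pose x_ k := - a + (2 * k%:R + 1) * d.
have Ex k : (k < N)%N -> E.[x_ k ^+ 2] <= 2 * L * z ^+ m.
  move=> kN; have kN' : k%:R + 1 <= N%:R :> R by rewrite natr1 ler_nat.
  have kd : (k%:R + 1) * d <= a by rewrite -dN ler_pM2r.
  have k0 : 0 <= k%:R * d by rewrite mulr_ge0 ?ler0n ?ltW.
  have xA : x_ k ^+ 2 < al ^+ 2.
    by rewrite -subr_gt0 subr_sqr mulr_gt0//; rewrite /x_; lra.
  have A2B2 : al ^+ 2 < be ^+ 2 by rewrite ltr_sqr ?nnegrE; lra.
  rewrite (le_trans (ler_norm _))//.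
  rewrite (le_trans (chebyshev_growth A2B2 _ sE EB xA)) ?mulr_gt0//.
  rewrite ler_pM2l ?mulr_gt0//.
  have /andP[_ T0] :=
    chebyshev_on_antitone m A2B2 (sqr_ge0 (x_ k)) (ltW xA).
  rewrite (le_trans T0)//.
  rewrite chebyshev_on_at0 ?(ltW al0)// -/z.
  have : z^-1 ^+ m <= z ^+ m.
    by rewrite (@le_trans _ _ 1)// ?exprn_ege1// exprn_ile1 ?invr_ge0 ?invf_le1; lra.
  lra.
have sumE : \sum_(0 <= k < N) E.[x_ k ^+ 2] = p.[a] - p.[- a].
  transitivity (\sum_(0 <= k < N) ((p.[- a + 2 * k.+1%:R * d] - p.[- a + 2 * k%:R * d])
      - (p.[a - 2 * k.+1%:R * d] - p.[a - 2 * k%:R * d])) / 2).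
    apply: eq_big_nat => k _; rewrite /E horner_even_poly !KE /x_ -(natr1 k).
    have -> : - a + (2 * k%:R + 1) * d + d = - a + 2 * (k%:R + 1) * d by ring.
    have -> : - a + (2 * k%:R + 1) * d - d = - a + 2 * k%:R * d by ring.
    have -> : - (- a + (2 * k%:R + 1) * d) + d = a - 2 * k%:R * d by ring.
    have -> : - (- a + (2 * k%:R + 1) * d) - d = a - 2 * (k%:R + 1) * d by ring.
    by ring.
  rewrite -mulr_suml sumrB !telescope_sumr//.
  have -> : - a + 2 * N%:R * d = a by rewrite -mulrA dN; ring.
  have -> : a - 2 * N%:R * d = - a by rewrite -mulrA dN; ring.
  by rewrite !mulr0 !mul0r addr0 subr0; field.
have sum_le : p.[a] - p.[- a] <= N%:R * (2 * L * z ^+ m).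
  rewrite -sumE -[N in N%:R]subn0 mulr_natl -sumr_const_nat.
  by apply: ler_sum_nat => k /andP[_ kN]; apply: Ex.
have := sgn_error_right p a0 (x := a) ltac:(lra).
have := sgn_error_left p a0 (x := a) ltac:(lra).
rewrite -/L !ler_norml; lra.
Qed.
End LowerBound.

(** * Upper bound for the best error *)

Section UpperBound.
Variable R : realType.
Implicit Types (a d x y z t : R) (p : {poly R}) (m n K : nat).

Lemma atan_increment (u v : R) : 0 <= u -> u < v ->
  (v - u) / (1 + v ^+ 2) <= atan v - atan u <= (v - u) / (1 + u ^+ 2).
Proof.
move=> u0 uv.
have [|c] := @MVT R atan (fun x => (1 + x ^+ 2)^-1) u v uv.
  by apply: continuous_subspaceT => x; exact: continuous_atan.
rewrite in_itv/= => /andP[uc cv] ->.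
have sq0 (x : R) : 0 < 1 + x ^+ 2 by rewrite ltr_wpDr ?sqr_ge0.
rewrite ![_^-1 * _]mulrC !ler_pM2l ?subr_gt0// !lef_pV2 ?posrE// !lerD2l.
by rewrite !ler_sqr ?nnegrE; lra.
Qed.

(** Riemann sums, with step [d] and [K] terms, of
    (2/pi) int_0^oo x/(x^2 + s^2) ds = 1. Their terms are compared with the
    increments of [atan (s / x)], which telescope. *)
Lemma stieltjes_sum a eta : 0 < a -> 0 < eta < 1 ->
  exists d, exists2 K, 0 < d & forall x, a <= x <= 1 ->
    `|1 - \sum_(0 <= k < K) 2 * d / pi * (x / (x ^+ 2 + (k%:R * d) ^+ 2))| <= eta.
Proof.
move=> a0 /andP[eta0 eta1]; have pi0 := pi_gt0 R; have pi2 := pi_ge2 R.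
pose d := eta * a.
have d0 : 0 < d by rewrite mulr_gt0.
(* at [X] the integral up to [X] already reaches 1 - eta *)
pose X := tan (pi / 2 * (1 - eta)).
pose K := (Num.truncn (X / d)).+1.
exists d, K => // x /andP[ax x1].
have x0 : 0 < x by apply: lt_le_trans ax.
pose h k := d * (x / (x ^+ 2 + (k%:R * d) ^+ 2)).
have hE k : h k = (k.+1%:R * d / x - k%:R * d / x) / (1 + (k%:R * d / x) ^+ 2).
  rewrite /h -natr1; field.
  have k0 : 0 <= k%:R * d by rewrite mulr_ge0// ltW.
  by rewrite !gt_eqF//; nra.
have h0 k : 0 <= h k.
  by rewrite !mulr_ge0 ?invr_ge0 ?addr_ge0 ?sqr_ge0// ltW.
have step k : h k.+1 <= atan (k.+1%:R * d / x) - atan (k%:R * d / x) <= h k.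
  have kk : k%:R * d / x < k.+1%:R * d / x.
    by rewrite ltr_pM2r ?invr_gt0// ltr_pM2r// ltr_nat.
  have [] := andP (@atan_increment (k%:R * d / x) _ _ kk).
    by rewrite !mulr_ge0 ?invr_ge0// ltW.
  rewrite -hE => lo ->; rewrite andbT (le_trans _ lo)// hE -[k.+2]addn1 natrD !mulrDl.
  rewrite -natr1; lra.
have tele : \sum_(0 <= k < K) (atan (k.+1%:R * d / x) - atan (k%:R * d / x)) =
    atan (K%:R * d / x).
  by rewrite telescope_sumr// !mul0r atan0 subr0.
have lo : pi / 2 * (1 - eta) <= \sum_(0 <= k < K) h k.
  apply: (@le_trans _ _ (atan (K%:R * d / x))); last first.
    by rewrite -tele; apply: ler_sum => k _; case/andP: (step k).
  rewrite -[leLHS](@tanK R) ?in_itv/=; last by apply/andP; split; nra.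
  apply: le_atan; rewrite -/X ler_pdivlMr//.
  have XK : X <= K%:R * d by rewrite -ler_pdivrMr// ltW// truncnS_gt.
  have [X0|X0] := leP 0 X; first by nra.
  have : 0 <= K%:R * d by rewrite mulr_ge0// ltW.
  nra.
have up : \sum_(0 <= k < K) h k <= eta + pi / 2.
  rewrite /K big_nat_recl//; apply: lerD.
    rewrite /h mul0r expr0n addr0 /d expr2 invfM mulVKf ?gt_eqF//.
    by rewrite ler_pdivrMr// ler_pM2l.
  apply: (@le_trans _ _ (atan (K%:R * d / x))); last exact/ltW/atan_ltpi2.
  rewrite -tele [leRHS]big_nat_recr//= -[leLHS]addr0; apply: lerD.
    by apply: ler_sum => k _; case/andP: (step k).
  by have /andP[lo1 _] := step (Num.truncn (X / d)); apply: le_trans lo1.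
have -> : \sum_(0 <= k < K) 2 * d / pi * (x / (x ^+ 2 + (k%:R * d) ^+ 2)) =
    (2 / pi) * \sum_(0 <= k < K) h k.
  by rewrite mulr_sumr; apply: eq_bigr => k _; rewrite /h; ring.
move: (\sum_(0 <= k < K) h k) lo up => S lo up.
have : 2 / pi * (pi / 2 * (1 - eta)) <= 2 / pi * S by rewrite ler_pM2l ?divr_gt0.
have : 2 / pi * S <= 2 / pi * (eta + pi / 2) by rewrite ler_pM2l ?divr_gt0.
have e1 : 2 / pi * (pi / 2) = 1 :> R by move: pi0; move: (pi : R) => P P0; field; exact: lt0r_neq0.
have e2 : 2 / pi * eta <= eta by rewrite ger_pMl// ler_pdivrMr// mul1r.
by rewrite mulrDr e1 mulrA e1 mul1r ler_norml; lra.
Qed.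

(** Each term x/(x^2 + t) of the Riemann sum is replaced by x (Q (x^2)), where
    Q y = (1 - C y / C (- t))/(y + t) is a polynomial since the numerator
    vanishes at - t. The errors x/(x^2 + t) C (x^2)/C (- t) add up to at most
    the full sum, close to 1, times the largest 1/C (- t). *)
Lemma odd_approximant m a eta : 0 < a < 1 -> 0 < eta < 1 ->
  exists2 q, admissible m q &
    sgn_error a q <= eta + (1 + eta) * (2 * ((1 - a) / (1 + a)) ^+ m.+1).
Proof.
move=> /andP[a0 a1] eta01; have [d [K d0 SK]] := stieltjes_sum a0 eta01.
pose C := chebyshev_on (a ^+ 2) (1 ^+ 2) m.+1.
pose rho := (1 - a) / (1 + a).
have rho0 : 0 < rho by rewrite divr_gt0; lra.
have a2 : a ^+ 2 < 1 ^+ 2 by rewrite ltr_sqr ?nnegrE; lra.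
have C1 y : a ^+ 2 <= y <= 1 -> `|C.[y]| <= 1.
  move=> /andP[ay y1]; rewrite horner_chebyshev_on; apply: chebyshev_norm_le1.
  rewrite expr1n in a2 *; have a2' : 0 < 1 - a ^+ 2 by rewrite subr_gt0.
  by rewrite ler_pdivlMr// ler_pdivrMr//; lra.
have C0 t : 0 <= t -> rho ^- m.+1 / 2 <= C.[- t].
  move=> t0; have tN : - t <= 0 by rewrite oppr_le0.
  have [_] := andP (@chebyshev_on_antitone R _ _ m.+1 _ 0 a2 tN (sqr_ge0 a)).
  rewrite chebyshev_on_at0 ?(ltW a0)//; apply: le_trans.
  rewrite invf_div -exprVn invf_div ler_pM2r ?invr_gt0// lerDl exprn_ge0//.
  by rewrite -invf_div invr_ge0 divr_ge0; lra.
pose w := 2 * d / pi.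
have w0 : 0 < w by rewrite !mulr_gt0 ?invr_gt0 ?pi_gt0.
pose t_ k := (k%:R * d) ^+ 2.
have t0 k : 0 <= t_ k by exact: sqr_ge0.
have Cgt0 k : 0 < C.[- t_ k].
  by apply: lt_le_trans (C0 _ (t0 k)); rewrite divr_gt0 ?invr_gt0 ?exprn_gt0.
pose G k := 1 - C.[- t_ k]^-1 *: C.
pose Q k := G k %/ ('X - (- t_ k)%:P).
have QE k : Q k * ('X - (- t_ k)%:P) = G k.
  by rewrite divpK// dvdp_XsubCl /root !hornerE mulVf ?subrr// gt_eqF.
have sQ k : (size (Q k) <= m.+1)%N.
  rewrite size_divp ?polyXsubC_eq0// size_XsubC/= leq_subLR add1n.
  rewrite (leq_trans (size_polyD _ _))// geq_max size_poly1 size_polyN.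
  by rewrite (leq_trans (size_scale_leq _ _))// size_chebyshev_on.
have hQ k x : 0 < x -> (Q k).[x ^+ 2] = (1 - C.[x ^+ 2] / C.[- t_ k]) / (x ^+ 2 + t_ k).
  move=> x0; have := congr1 (horner^~ (x ^+ 2)) (QE k).
  rewrite /G hornerM hornerXsubC opprK !hornerE [_^-1 * _]mulrC => <-.
  by rewrite mulfK// gt_eqF// ltr_wpDr// exprn_gt0.
pose q := \sum_(0 <= k < K) w *: ('X * (Q k \Po 'X^2)).
have qE x : q.[x] = \sum_(0 <= k < K) w * (x * (Q k).[x ^+ 2]).
  by rewrite horner_sum; apply: eq_bigr => k _; rewrite !hornerE horner_comp !hornerE.
have qN x : q.[- x] = - q.[x].
  by rewrite !qE -sumrN; apply: eq_bigr => k _; rewrite sqrrN mulNr mulrN.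
have err x : a <= x <= 1 -> `|q.[x] - 1| <= eta + (1 + eta) * (2 * rho ^+ m.+1).
  move=> /[dup] /SK S1 /andP[ax x1].
  have x0 : 0 < x by apply: lt_le_trans ax.
  have x2 : a ^+ 2 <= x ^+ 2 <= 1.
    rewrite ler_sqr ?nnegrE ?ax ?expr_le1 ?x1//; lra.
  pose c k := w * (x / (x ^+ 2 + t_ k)).
  have c0 k : 0 <= c k.
    rewrite mulr_ge0 ?(ltW w0)// divr_ge0 ?(ltW x0)//.
    by rewrite addr_ge0 ?sqr_ge0 ?t0.
  rewrite -/w in S1; rewrite -[X in `|1 - X|]/(\sum_(0 <= k < K) c k) in S1.
  have -> : q.[x] - 1 = - (1 - \sum_(0 <= k < K) c k)
      - \sum_(0 <= k < K) c k * (C.[x ^+ 2] / C.[- t_ k]).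
    rewrite qE opprB addrAC -sumrB; congr (_ - _); apply: eq_bigr => k _.
    by rewrite hQ// /c; ring.
  rewrite (le_trans (ler_normB _ _))// normrN lerD//.
  have sumc : \sum_(0 <= k < K) c k <= 1 + eta by move: S1; rewrite ler_norml; lra.
  have r0 : 0 < 2 * rho ^+ m.+1 by rewrite mulr_gt0 ?exprn_gt0.
  rewrite (le_trans (ler_norm_sum _ _ _))//.
  apply: (@le_trans _ _ ((\sum_(0 <= k < K) c k) * (2 * rho ^+ m.+1))); last first.
    by rewrite ler_pM2r.
  rewrite mulr_suml; apply: ler_sum => k _.
  rewrite normrM (ger0_norm (c0 k)) ler_wpM2l// normrM.
  rewrite (gtr0_norm (x := _^-1)) ?invr_gt0//.
  rewrite ler_pdivrMr// (le_trans (C1 _ x2))//.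
  have := C0 _ (t0 k); rewrite -(ler_pM2l r0); apply: le_trans.
  have u0 : rho ^+ m.+1 != 0 by rewrite gt_eqF// exprn_gt0.
  by rewrite mulrACA mulrC -mulrA mulKf ?pnatr_eq0// mulfV.

exists q.
  rewrite /admissible/= (leq_trans (size_sum _ _ _))//.
  apply/bigmax_leqP_seq => k _ _; rewrite (leq_trans (size_scale_leq _ _))//.
  rewrite mulrC (leq_trans (size_polyMleq _ _))// size_polyX addn2/= ltnS.
  rewrite (leq_trans (size_comp_poly_leq _ _))// size_polyXn/= addn1 mulnC ltnS leq_mul//.
  by have := sQ k; case: (size (Q k)).
apply: sgn_error_le => [|//|x /err]; first by rewrite a0 ltW.
by rewrite qN -normrN opprD opprK.
Qed.

Lemma best_error_upper_bound m a p : 0 < a < 1 -> best_sgn_approx m a p ->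
  sgn_error a p <= 2 * ((1 - a) / (1 + a)) ^+ m.+1.
Proof.
move=> a01 [_ pbest]; set r := 2 * _.
have r0 : 0 <= r by rewrite mulr_ge0// exprn_ge0// divr_ge0; lra.
apply/ler_addgt0Pr => e e0.
pose eta := Num.min (e / (1 + r)) (2^-1).
have eta01 : 0 < eta < 1 by rewrite lt_min gt_min divr_gt0//=; lra.
have [q /pbest pq qe] := odd_approximant m a01 eta01.
rewrite (le_trans pq)// (le_trans qe)// -/r.
have : eta * (1 + r) <= e by rewrite -ler_pdivlMr ?ge_min ?lexx//; lra.
lra.
Qed.
End UpperBound.

(** * Asymptotics of the fixed point *)

Section FixedPointAsymptotics.
Variable R : realType.
Implicit Types (x eps : R) (m N : nat).

Lemma upper_bound_exp x m : 0 < x < 1 ->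
  ((1 - x) / (1 + x)) ^+ m.+1 <= expR (- (2 * m%:R * x / (1 + x))).
Proof.
move=> /andP[x0 x1]; have r0 : 0 <= (1 - x) / (1 + x) by rewrite divr_ge0; lra.
have r1 : (1 - x) / (1 + x) <= 1 by rewrite ler_pdivrMr; lra.
rewrite exprS (le_trans (ler_piMl _ r1)) ?exprn_ge0//.
have -> : - (2 * m%:R * x / (1 + x)) = m%:R * - (2 * x / (1 + x)) by ring.
rewrite expRM_natl lerXn2r ?nnegrE ?expR_ge0// (le_trans _ (expR_ge1Dx _))//.
by rewrite le_eqVlt; apply/orP; left; apply/eqP; field; rewrite gt_eqF//; lra.
Qed.

Lemma lower_bound_exp (al be : R) m : 0 < al < be ->
  ((be + al) / (be - al)) ^+ m <= expR (m%:R * (2 * al / (be - al))).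
Proof.
move=> /andP[al0 ab]; have d0 : 0 < be - al by rewrite subr_gt0.
have z0 : 0 <= (be + al) / (be - al) by rewrite divr_ge0; lra.
rewrite expRM_natl lerXn2r ?nnegrE ?expR_ge0//.
rewrite (le_trans _ (expR_ge1Dx _))//.
by rewrite le_eqVlt; apply/orP; left; apply/eqP; field; rewrite gt_eqF.
Qed.

(** A first crude estimate, from [1 + t <= expR t]; it makes the factor
    1/(1 + x) in the exponent harmless. *)
Lemma fixed_point_small x m : (0 < m)%N -> 0 < x < 1 ->
  x <= 2 * expR (- (2 * m%:R * x / (1 + x))) -> x ^+ 2 <= 2 / m%:R.
Proof.
move=> m0 /andP[x0 x1] xU; have m0' : 0 < m%:R :> R by rewrite ltr0n.
set t := 2 * m%:R * x / (1 + x) in xU.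
have t0 : 0 < t by rewrite divr_gt0 ?mulr_gt0//; lra.
have xt : x * (1 + t) <= 2.
  rewrite (le_trans (ler_wpM2l (ltW x0) (expR_ge1Dx t)))//.
  by rewrite -ler_pdivlMr ?expR_gt0// -expRN.
have tE : t * (1 + x) = 2 * m%:R * x by rewrite divfK// gt_eqF//; lra.
rewrite ler_pdivlMr//.
have : x * t * (1 + x) <= 2 * (1 + x).
  by rewrite ler_pM2r; [nra|lra].
rewrite -mulrA tE; nra.
Qed.

(** If [m x] were larger, the exponent would be at least [ln m], whence
    x <= 2/m, whereas x > ln m/(2m). *)
Lemma fixed_point_le x eps m : 0 < x < 1 -> 0 < eps ->
  x <= 2 * expR (- (2 * m%:R * x / (1 + x))) -> x <= 2 * eps ->
  4 <= ln (m%:R : R) -> m%:R * x <= (1 / 2 + eps) * ln (m%:R).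
Proof.
move=> /andP[x0 x1] eps0 xU xeps lm; set l := ln m%:R in lm *.
have m0 : 0 < m%:R :> R.
  rewrite ltr0n lt0n; apply: contraTneq lm => m0.
  by rewrite /l m0 ln0// -ltNge.
rewrite leNgt; apply/negP => big.
have le_l : l <= 2 * m%:R * x / (1 + x) by rewrite ler_pdivlMr; nra.
have : x <= 2 * m%:R^-1.
  rewrite (le_trans xU)// ler_pM2l// -[X in _ <= X^-1]lnK ?posrE// -expRN.
  by rewrite ler_expR lerN2.
rewrite ler_pdivlMr// mulrC; nra.
Qed.

(** If [m x] were smaller, the lower bound would give
    1 <= (N+1) x m^(1-eps) with x < ln m/(2m), that is
    m^eps <= (N+1) ln m / 2, while m^eps >= (eps ln m)^2 / 2. *)
Lemma fixed_point_ge x eps m N : 0 < x < 1 -> 0 < eps <= 1 / 2 -> (0 < N)%N ->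
  N%:R^-1 <= eps / 2 -> x <= eps / 12 ->
  (forall al be : R, al = x + x / N%:R -> be = 1 - x / N%:R -> al < be ->
    1 <= x * (1 + N%:R * ((be + al) / (be - al)) ^+ m)) ->
  0 < ln (m%:R : R) -> N.+1%:R / eps ^+ 2 < ln (m%:R : R) ->
  (1 / 2 - eps) * ln (m%:R) <= m%:R * x.
Proof.
move=> /andP[x0 x1] /andP[eps0 eps1] N0 Neps xeps xL l0 lN.
set l := ln m%:R in l0 lN *.
have m0 : 0 < m%:R :> R.
  rewrite ltr0n lt0n; apply: contraTneq l0 => m0.
  by rewrite /l m0 ln0// ltxx.
have lE : expR l = m%:R by rewrite lnK.
have N0' : 0 < N%:R :> R by rewrite ltr0n.
have iN0 : 0 < (N%:R : R)^-1 by rewrite invr_gt0.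
rewrite leNgt; apply/negP => small.
pose al := x + x / N%:R; pose be := 1 - x / N%:R.
have xN : x / N%:R <= x / 2 by rewrite ler_pM2l//; lra.
have xN0 : 0 < x / N%:R by rewrite divr_gt0.
have ab : 0 < al < be by rewrite /al /be; lra.
have d0 : 0 < be - al by rewrite /al /be; lra.
have expo : m%:R * (2 * al / (be - al)) <= (1 - eps) * l.
  have : 2 * al / (be - al) <= 2 * x * (1 + eps).
    rewrite ler_pdivrMr// /al /be.
    have : x / N%:R <= x * (eps / 2) by rewrite ler_pM2l.
    have : x * x <= x * (eps / 12) by rewrite ler_pM2l.
    nra.
  move=> /(ler_wpM2l (ltW m0)) h; rewrite (le_trans h)//.
  nra.
have := xL al be erefl erefl; case/andP: (ab) => _ ab' /(_ ab').
apply/negP; rewrite -ltNge.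
have pw : ((be + al) / (be - al)) ^+ m <= expR ((1 - eps) * l).
  by rewrite (le_trans (lower_bound_exp m ab))// ler_expR.
have e1 : 1 <= expR ((1 - eps) * l) by rewrite (le_trans _ (expR_ge1Dx _))// lerDl mulr_ge0//; lra.
have {}e1 : 1 + N%:R * ((be + al) / (be - al)) ^+ m <=
    N.+1%:R * expR ((1 - eps) * l).
  by rewrite -natr1; nra.
apply: le_lt_trans (ler_wpM2l (ltW x0) e1) _.
have -> : (1 - eps) * l = l - eps * l by ring.
rewrite expRB lE.
have el : (eps * l) ^+ 2 / 2 < expR (eps * l).
  have := @expR_ge1Dxn R (eps * l) 1 ltac:(nra).
  by rewrite -[2`!%:R]/(2%:R : R); lra.
rewrite !mulrA ltr_pdivrMr ?expR_gt0// mul1r (lt_trans _ el)//.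
have lN' : N.+1%:R < l * eps ^+ 2 by rewrite -ltr_pdivrMr ?exprn_gt0.
have mx : m%:R * x < l / 2 by nra.
have N1 : 0 < N.+1%:R :> R by rewrite ltr0n.
have -> : x * N.+1%:R * m%:R = (m%:R * x) * N.+1%:R by ring.
have h1 : m%:R * x * N.+1%:R < l / 2 * N.+1%:R by rewrite ltr_pM2r.
have h2 : l / 2 * N.+1%:R < l / 2 * (l * eps ^+ 2) by rewrite ltr_pM2l//; lra.
rewrite (lt_trans h1)// (lt_le_trans h2)// exprMn.
by rewrite le_eqVlt; apply/orP; left; apply/eqP; ring.
Qed.
End FixedPointAsymptotics.

Theorem theorem5 (R : realType) (a : nat -> R) (p : nat -> {poly R})
  (a_itv : forall m : nat, (0 < m)%N -> 0 < a m < 1)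
  (a_fix : forall m : nat, (0 < m)%N -> a m = best_sgn_error m (a m))
  (p_best : forall m : nat, (0 < m)%N -> best_sgn_approx m (a m) (p m)) :
  (fun m : nat => m%:R / ln (m%:R : R) *
     levy_dist (Num.sg : R -> R) (fun x : R => (p m).[x])) @ \oo
    --> (1 / 2 : R).
Proof.
have errE m : (0 < m)%N -> sgn_error (a m) (p m) = a m.
  move=> m0; rewrite [RHS]a_fix// (best_sgn_errorE _ (p_best m m0))//.
  by case/andP: (a_itv m m0) => -> /ltW.
have aU m : (0 < m)%N -> a m <= 2 * expR (- (2 * m%:R * a m / (1 + a m))).
  move=> m0; rewrite -[leLHS]errE//.
  rewrite (le_trans (best_error_upper_bound (a_itv m m0) (p_best m m0)))//.
  by rewrite ler_pM2l// upper_bound_exp// a_itv.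
apply/cvgrPdist_le => e e0.
pose eps := Num.min e (1 / 2).
have eps0 : 0 < eps <= 1 / 2 by rewrite lt_min e0 ge_min lexx orbT; lra.
have /andP[eps_gt0 _] := eps0.
have eps_e : eps <= e by rewrite ge_min lexx.
pose N := (Num.truncn (2 / eps)).+1.
have N0 : 0 < N%:R :> R by rewrite ltr0n.
have Neps : N%:R^-1 <= eps / 2.
  by rewrite -[leRHS]invf_div lef_pV2 ?posrE ?divr_gt0// ltW// truncnS_gt.
(* [ln m >= C] provides the two size conditions on [ln m] required below *)
pose C := Num.max 4 (N.+1%:R / eps ^+ 2 + 1).
near=> m.
have m0 : (0 < m)%N by near: m; exact: nbhs_infty_gt.
have m0' : 0 < m%:R :> R by rewrite ltr0n.
have lC : C <= ln m%:R.
  rewrite -[C]expRK ler_ln ?posrE ?expR_gt0//; near: m; exact: nbhs_infty_ger.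
have : 2 / (eps / 12) ^+ 2 <= m%:R by near: m; exact: nbhs_infty_ger.
rewrite ler_pdivrMr ?exprn_gt0 ?divr_gt0// mulrC -ler_pdivrMr// => m_eps.
have /andP[am0 am1] := a_itv m m0.
have am_eps : a m <= eps / 12.
  rewrite -ler_sqr ?nnegrE ?(ltW am0) ?divr_ge0 ?(ltW eps_gt0)//.
  by rewrite (le_trans _ m_eps)// fixed_point_small ?aU ?a_itv.
move: lC; rewrite ge_max => /andP[l4 lN].
have l0 : 0 < ln (m%:R : R) by lra.
rewrite (levy_dist_best_approx (a_itv m m0) (p_best m m0) (errE m m0)).
have up := @fixed_point_le _ (a m) eps m (a_itv m m0) eps_gt0 (aU m m0)
  ltac:(lra) l4.
have lo := @fixed_point_ge _ (a m) eps m N (a_itv m m0) eps0 isT Neps am_eps.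
have {}lo : (1 / 2 - eps) * ln m%:R <= m%:R * a m.
  apply: lo => //; last lra.
  move=> al be alE beE ab; rewrite -[X in _ <= X * _]errE//.
  have [pm _] := p_best m m0.
  by apply: sgn_error_lower_bound alE beE ab; rewrite ?errE.
have y_le : m%:R / ln m%:R * a m <= 1 / 2 + eps by rewrite mulrAC ler_pdivrMr.
have y_ge : 1 / 2 - eps <= m%:R / ln m%:R * a m by rewrite mulrAC ler_pdivlMr.
by rewrite ler_norml; lra.
Unshelve. all: by end_near.
Qed.
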